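(* Let $A$ be any finite alphabet and let $x\in A^\omega$ be an aperiodic balanced word. Then $x\in\mathcal P_3$.
   Context: For a finite word $u$ and a letter $a$, $|u|$ is the length of $u$ and $|u|_a$ the number of occurrences of $a$ in $u$. An infinite word $x\in A^\omega$ is aperiodic if it is not of the form $vu^\omega$ with $v\in A^*$ (possibly empty) and $u$ a non-empty finite word. It is balanced if for every letter $a\in A$ and all factors $u,v$ of $x$ with $|u|=|v|$ one has $\big||u|_a-|v|_a\big|\le1$. $\mathrm{Fact}^+x$ is the set of non-empty finite factors (contiguous blocks) of $x$. A factorization of $x$ is an expression $x=U_1U_2U_3\cdots$ with all $U_i$ non-empty finite words. For $k\ge 2$, $\mathcal P_k$ is the class of infinite words $x$ over finite alphabets for which there is a map (coloring) $c:\mathrm{Fact}^+x\to C$ with $\mathrm{card}(C)=k$ such that for each factorization $x=U_1U_2U_3\cdots$ there exist $i,j\ge1$ with $c(U_i)\ne c(U_j)$. *)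

(* Defs.v *)
From mathcomp Require Import all_boot.
From mathcomp Require Export ssrint.

Set Implicit Arguments.
Unset Strict Implicit.
Unset Printing Implicit Defensive.

(* An infinite word is a map [nat -> A], with letters indexed from 0. *)

Definition block (A : Type) (x : nat -> A) (i n : nat) : seq A :=
  [seq x j | j <- iota i n].

Definition is_factor (A : Type) (x : nat -> A) (u : seq A) : Prop :=
  exists i : nat, u = block x i (size u).

Definition is_prefix (A : Type) (x : nat -> A) (u : seq A) : Prop :=
  u = block x 0 (size u).

(* [x = v u u u ...]: as [u] is non-empty, the finite words [v u^n] have
   unbounded length, so having all of them as prefixes determines [x]. *)
Definition ultimately_periodic (A : Type) (x : nat -> A) : Prop :=
  exists v u : seq A,
    u <> [::] /\ forall n : nat, is_prefix x (v ++ flatten (nseq n u)).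

Definition aperiodic (A : Type) (x : nat -> A) : Prop :=
  ~ ultimately_periodic x.

(* The minus sign inside [`|_ - _|%N] is integer, not truncated, subtraction. *)
Definition balanced (A : finType) (x : nat -> A) : Prop :=
  forall (a : A) (u v : seq A),
    is_factor x u -> is_factor x v -> size u = size v ->
    `|count_mem a u - count_mem a v|%N <= 1.

(* [x = U 0 U 1 U 2 ...] with all [U i] non-empty: every finite product
   [U 0 ... U (n-1)] is a prefix of [x], and their lengths are unbounded. *)
Definition factorization (A : Type) (x : nat -> A) (U : nat -> seq A) : Prop :=
  (forall i : nat, U i <> [::]) /\
  (forall n : nat, is_prefix x (flatten (mkseq U n))).

(* The class P_k, meant for [k >= 2].  The colouring is total on finite words,
   but every [U i] in a factorization of [x] is a non-empty factor of [x], so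
   only its restriction to those factors matters. *)
Definition in_P (k : nat) (A : finType) (x : nat -> A) : Prop :=
  exists (C : finType) (c : seq A -> C),
    #|C| = k /\
    forall U : nat -> seq A,
      factorization x U -> exists i j : nat, c (U i) <> c (U j).

(* Main.v *)
(* Order the letters, hence the infinite words lexicographically. As x is not
   periodic, cutting off a non-empty prefix u from x leaves a word distinct from
   x. Colour a non-empty word according to whether it is not a prefix of x, or a
   prefix whose removal increases x, or a prefix whose removal decreases x.
   In a monochromatic factorization x = U_0 U_1 ... the word U_0 is a prefix of
   x, so all U_i are; say that removing any of them increases x.  Then every
   tail y_m = U_m U_{m+1} ... is at most x: if x < y_m, then removing the
   common prefix U_m gives x < U_m^{-1} x < y_{m+1}, with an earlier first
   difference, and this descent cannot go on. But y_1 = U_0^{-1} x > x. *)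

Require Import Defs.
From mathcomp Require Import all_boot.
From mathcomp Require Import boolp.

Set Implicit Arguments.
Unset Strict Implicit.
Unset Printing Implicit Defensive.

Definition shift (A : Type) (n : nat) (x : nat -> A) : nat -> A :=
  fun j => x (n + j).

(** The position [k] of the first difference is explicit because the descent is an induction on
    it. *)
Definition lexlt_at (A : Type) (r : rel A) (x y : nat -> A) (k : nat) : Prop :=
  (forall j, j < k -> x j = y j) /\ r (x k) (y k).

Definition lexlt (A : Type) (r : rel A) (x y : nat -> A) : Prop :=
  exists k, lexlt_at r x y k.

(** At [minn p q] one comparison is strict and the other is strict or an equality. The bound by [q]
    is what the descent uses. *)
Lemma lexlt_at_trans (A : Type) (r : rel A) (x y z : nat -> A) (p q : nat) :
  transitive r -> lexlt_at r x y p -> lexlt_at r y z q ->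
  lexlt_at r x z (minn p q).
Proof.
move=> rT [xy rxy] [yz ryz]; split=> [j|].
  by rewrite ltn_min => /andP[/xy -> /yz].
case: (ltngtP p q) => [pq|qp|pq].
- by rewrite -yz.
- by rewrite xy.
- by apply: rT rxy _; rewrite pq.
Qed.

Lemma lexlt_total (A : eqType) (r : rel A) (x y : nat -> A) :
  (forall a b, a != b -> r a b || r b a) -> (exists k, x k != y k) ->
  lexlt r x y \/ lexlt r y x.
Proof.
move=> r_tot neq_xy; case: (ex_minnP neq_xy) => k neq_k min_k.
have eq_lt j : j < k -> x j = y j.
  by move=> lt_jk; apply/eqP; apply: contraLR lt_jk => /min_k; rewrite -leqNgt.
case/orP: (r_tot _ _ neq_k) => r_k; [left | right]; exists k; split=> // j.
by move/eq_lt.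
Qed.

Lemma block_cat (A : Type) (x : nat -> A) (i m n : nat) :
  block x i (m + n) = block x i m ++ block x (i + m) n.
Proof. by rewrite /block iotaD map_cat. Qed.

Lemma size_block (A : Type) (x : nat -> A) (i n : nat) : size (block x i n) = n.
Proof. by rewrite size_map size_iota. Qed.

Lemma nth_block (A : Type) (a : A) (x : nat -> A) (i n j : nat) :
  j < n -> nth a (block x i n) j = x (i + j).
Proof. by move=> lt_jn; rewrite (nth_map 0) ?size_iota // nth_iota. Qed.

(** Otherwise [x] would be an infinite power of its prefix of length [n], so periodic with [v]
    empty. *)
Lemma aperiodic_shift (A : eqType) (x : nat -> A) (n : nat) :
  aperiodic x -> 0 < n -> exists k, x k != shift n x k.
Proof.
move=> x_aper n_gt0; apply: contrapT => no_diff; apply: x_aper.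
have per k : x (n + k) = x k.
  by apply/esym/eqP; apply: contrapT => /negP ?; apply: no_diff; exists k.
have block_shift l : block x n l = block x 0 l.
  rewrite /block -[n in iota n]addn0 iotaDl -map_comp.
  by apply: eq_map => k /=; rewrite per.
exists [::], (block x 0 n); split.
  by move/(congr1 size); rewrite size_block => n0; rewrite n0 in n_gt0.
elim=> [|m IHm] //=; rewrite /is_prefix size_cat size_block block_cat.
by rewrite add0n block_shift; congr (_ ++ _).
Qed.

Lemma factorization_block (A : Type) (x : nat -> A) (U : nat -> seq A) (m : nat) :
  factorization x U ->
  U m = block x (size (flatten (mkseq U m))) (size (U m)).
Proof.
case=> _ pref; have := pref m.+1.
rewrite /is_prefix mkseqS flatten_rcons size_cat block_cat -pref add0n.
move/(congr1 (drop (size (flatten (mkseq U m))))).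
by rewrite !drop_size_cat.
Qed.

(** Here [r] is arbitrary, so as to serve both for the order of the letters and for its reverse. *)
Lemma no_increasing_factorization (A : Type) (r : rel A) (x : nat -> A)
    (U : nat -> seq A) :
  irreflexive r -> transitive r -> factorization x U ->
  (forall i, is_prefix x (U i)) ->
  ~ (forall i, lexlt r x (shift (size (U i)) x)).
Proof.
move=> rI rT facU prefU incr.
pose s m := size (flatten (mkseq U m)).
have sS m : s m.+1 = s m + size (U m).
  by rewrite /s mkseqS flatten_rcons size_cat.
have common m j : j < size (U m) -> x j = x (s m + j).
  move=> lt_j; rewrite -(nth_block (x 0) x (s m) lt_j).
  by rewrite -factorization_block // prefU nth_block.
have U_gt0 m : 0 < size (U m).
  by case: facU => /(_ m) + _; case: (U m).
(* Induction on a bound [N] for [k], over all tails at once, as each step passes from [m] to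
   [m.+1]. *)
have tail_le N m k : k < N -> ~ lexlt_at r x (shift (s m) x) k.
  elim: N => // N IHN in m k * => lt_kN [eq_lt r_k].
  have [lt_k|le_k] := ltnP k (size (U m)).
    by move: r_k; rewrite /shift -common // rI.
  have [p x_lt] := incr m.
  pose k' := k - size (U m).
  have kE : k = size (U m) + k' by rewrite subnKC.
  have tail_lt : lexlt_at r (shift (size (U m)) x) (shift (s m.+1) x) k'.
    rewrite /shift sS; split=> [j lt_j|]; rewrite -addnA.
      by apply: eq_lt; rewrite kE ltn_add2l.
    by rewrite -kE.
  (* The new first difference is at most [k'], and [k' < k] as [U m] is non-empty. *)
  apply: IHN (lexlt_at_trans rT x_lt tail_lt).
  apply: leq_ltn_trans (geq_minr _ _) _.
  by rewrite -ltnS; apply: leq_trans lt_kN; rewrite ltnS kE -addn1 addnC leq_add2r.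
have [k] := incr 0.
have -> : size (U 0) = s 1 by rewrite sS.
exact: tail_le (ltnSn k).
Qed.

Theorem corollary6p11 (A : finType) (x : nat -> A) :
  aperiodic x -> balanced x -> in_P 3 x.
Proof.
move=> x_aper _.
pose r : rel A := fun a b => enum_rank a < enum_rank b.
have rI : irreflexive r by move=> a; apply: ltnn.
have rT : transitive r by move=> b a c; apply: ltn_trans.
have r_tot a b : a != b -> r a b || r b a.
  by rewrite /r -neq_ltn (inj_eq val_inj) (inj_eq enum_rank_inj).
pose r' : rel A := fun a b => r b a.
have r'T : transitive r' by move=> b a c ba cb; apply: rT cb ba.
pose c (u : seq A) : 'I_3 :=
  if `[< is_prefix x u >] then
    if `[< lexlt r x (shift (size u) x) >] then inord 1 else inord 2
  else ord0.
exists 'I_3, c; split=> [|U facU]; first exact: card_ord.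
apply: contrapT => no_diff.
have mono i : c (U i) = c (U 0).
  by apply: contrapT => ?; apply: no_diff; exists i, 0.
(* As [mkseq U 0] is empty, the block given for [U 0] starts at 0. *)
have prefU0 : is_prefix x (U 0) := factorization_block 0 facU.
have prefU i : is_prefix x (U i).
  apply: contrapT => not_pref; have := mono i.
  rewrite /c (asboolF not_pref) (asboolT prefU0).
  by case: ifP => _ /(congr1 val); rewrite /= inordK.
have [incr0|decr0] := pselect (lexlt r x (shift (size (U 0)) x)).
  apply: (no_increasing_factorization rI rT facU prefU) => i.
  apply: contrapT => not_incr; have := mono i.
  rewrite /c !(asboolT (prefU _)) (asboolT incr0) (asboolF not_incr).
  by move/(congr1 val); rewrite /= !inordK.
apply: (@no_increasing_factorization _ r' _ _ _ r'T facU prefU) => [//|i].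
have not_incr : ~ lexlt r x (shift (size (U i)) x).
  move=> incr; have := mono i.
  rewrite /c !(asboolT (prefU _)) (asboolT incr) (asboolF decr0).
  by move/(congr1 val); rewrite /= !inordK.
have U_gt0 : 0 < size (U i) by case: facU => /(_ i) + _; case: (U i).
(* By aperiodicity the two words differ, so not increasing for [r] means increasing for [r']. *)
have [//|[k [eq_lt r_k]]] := lexlt_total r_tot (aperiodic_shift x_aper U_gt0).
by exists k; split=> // j /eq_lt.
Qed.
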